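(* Let $p$ be an odd prime and $s,h\in\mathbb{N}$ with $s>1$ and $h>1$. Let $y_1,\ldots,y_m\in\mathbb{Z}_{2p^s}$ (viewed as integers in $\{0,\ldots,2p^s-1\}$) with $p\nmid y_i$ for $1\le i\le m$, and let $S=\{(y_i,0,\ldots,0),(2p^s-y_i,0,\ldots,0): 1\le i\le m\}\subseteq\mathbb{Z}_{2p^s}^h$. If $a,b\in\mathbb{Z}_{2p^s}^h$ with $b-a=(p^s,0,\ldots,0)$, then the complement of $\mathrm{Cay}(\mathbb{Z}_{2p^s}^h,S)$ does not exhibit PGST between $a$ and $b$.
   Context: For a finite abelian group $G$ (written additively) and $S\subseteq G\setminus\{0\}$ with $S=-S$, the Cayley graph $\mathrm{Cay}(G,S)$ has vertex set $G$, two distinct vertices $a,b$ being adjacent iff $b-a\in S$; its complement is $\mathrm{Cay}(G,G\setminus(S\cup\{0\}))$. For a graph $\Gamma$ with adjacency matrix $A$, the transition matrix is $H(t)=\exp(-\mathbf{i}tA)$, $t\in\mathbb{R}$, and $\mathbf{e}_v$ is the standard basis vector of vertex $v$. $\Gamma$ exhibits pretty good state transfer (PGST) between distinct vertices $a$ and $b$ if there is a sequence of real numbers $\{t_k\}$ and $\gamma\in\mathbb{C}$ with $|\gamma|=1$ such that $\lim_{k\to\infty}H(t_k)\mathbf{e}_a=\gamma\mathbf{e}_b$. *)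

(* Defs.v *)
From HB Require Import structures.
From mathcomp Require Import all_boot all_order all_algebra.
From mathcomp Require Import complex.
From mathcomp Require Import all_classical all_reals all_analysis.

Set Implicit Arguments.
Unset Strict Implicit.
Unset Printing Implicit Defensive.

Import Order.TTheory GRing.Theory Num.Theory.
Import numFieldNormedType.Exports.

Local Open Scope classical_set_scope.
Local Open Scope ring_scope.
Local Open Scope complex_scope.

(* R[i] as a numClosedFieldType, so that it carries the topology of its norm;
   the bare type R[i] has no canonical topology. *)
Definition Cplx (R : realType) : numClosedFieldType := R[i].

(* Limit of the partial sums of \sum_k M ^+ k / k`!, for the entrywise
   topology on matrices. *)
Definition expmx (K : numClosedFieldType) (n : nat) (M : 'M[K]_n) : 'M[K]_n :=
  limn (series (fun k : nat => (k`!%:R)^-1 *: M ^+ k)).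

(* A graph on the finite type V is given by its adjacency relation; matrices
   and vectors over V are indexed through the enumeration of V. *)
Section Graphs.
Variables (R : realType) (V : finType) (e : rel V).

Definition graph_compl : rel V := fun a b => (a != b) && ~~ e a b.

Definition adjmx : 'M[Cplx R]_#|V| :=
  \matrix_(i, j) (e (enum_val i) (enum_val j))%:R.

Definition transmx (t : R) : 'M[Cplx R]_#|V| :=
  expmx ((- 'i * (t%:C : Cplx R)) *: adjmx).

Definition vertex_vec (v : V) : 'cV[Cplx R]_#|V| :=
  delta_mx (enum_rank v) ord0.

Definition pgst (a b : V) : Prop :=
  exists (t : nat -> R) (gamma : Cplx R),
    `|gamma| = 1 /\
    (fun k : nat => transmx (t k) *m vertex_vec a) @ \oo
      --> gamma *: vertex_vec b.

End Graphs.

Arguments pgst R {V} e a b.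

Definition cayley (G : finZmodType) (S : {set G}) : rel G :=
  fun a b => (a != b) && (b - a \in S).

Lemma graph_compl_cayley (G : finZmodType) (S : {set G}) :
  graph_compl (cayley S) =2 cayley (~: (0 |: S)%SET).
Proof.
move=> a b; rewrite /graph_compl /cayley !inE subr_eq0 [b == a]eq_sym.
by case: (a == b).
Qed.

(* The vector (z, 0, ..., 0) of Z_n^h. *)
Definition first_axis (n h : nat) (z : 'Z_n) : 'rV['Z_n]_h :=
  \row_(j < h) (if j == 0%N :> nat then z else 0).

(* The integer n - y i is reduced modulo n by the cast to 'Z_n. *)
Definition axis_conn (n h m : nat) (y : 'I_m -> 'Z_n) : {set 'rV['Z_n]_h} :=
  ([set first_axis h (y i) | i : 'I_m]
   :|: [set first_axis h (n - y i)%N%:R | i : 'I_m])%SET.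

Lemma axis_connN (n h m : nat) (y : 'I_m -> 'Z_n) (x : 'rV['Z_n]_h) :
  (1 < n)%N -> (- x \in axis_conn h y) = (x \in axis_conn h y).
Proof.
move=> n_gt1.
have E (z : 'Z_n) : first_axis h (n - z)%N%:R = - first_axis h z :> 'rV['Z_n]_h.
  apply/rowP => j; rewrite !mxE; case: ifP => _; last by rewrite oppr0.
  have zn : (z <= n)%N by rewrite -[X in (_ <= X)%N](Zp_cast n_gt1) ltnW.
  by rewrite natrB // pchar_Zp // natr_Zp sub0r.
have imp x' : x' \in axis_conn h y -> - x' \in axis_conn h y.
  rewrite /axis_conn !finset.inE => /orP[] /imsetP[i _ ->]; apply/orP.
    by right; apply/imsetP; exists i => //; rewrite E.
  by left; apply/imsetP; exists i => //; rewrite E opprK.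
by apply/idP/idP => /imp //; rewrite opprK.
Qed.

Lemma axis_conn0 (p s h m : nat) (y : 'I_m -> 'Z_(2 * p ^ s)) :
    prime p -> (0 < s)%N -> (0 < h)%N -> (forall i, ~~ (p %| y i)%N) ->
  0 \notin axis_conn h y.
Proof.
move=> p_pr s_gt0 h_gt0 py; set n := (2 * p ^ s)%N in y py *.
have n_gt1 : (1 < n)%N.
  by apply: (@leq_trans (2 * 1)%N); rewrite // leq_mul2l expn_gt0 prime_gt0.
have pn : (p %| n)%N by rewrite dvdn_mull // dvdn_exp.
pose j0 := Ordinal h_gt0.
have coord (z : 'Z_n) : 0 = first_axis h z :> 'rV['Z_n]_h -> z = 0.
  by move=> /matrixP/(_ ord0 j0); rewrite !mxE /= => ->.
rewrite finset.inE; apply/norP; split; apply/negP => /imsetP[i _ /coord].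
  by move=> yi0; move: (py i); rewrite yi0 dvdn0.
move=> /(congr1 val); rewrite /= val_Zp_nat // => /eqP nyi.
have yn : (y i <= n)%N by rewrite -[X in (_ <= X)%N](Zp_cast n_gt1) ltnW.
have : (p %| n - y i)%N by apply: dvdn_trans pn nyi.
by rewrite dvdn_subr // (negPf (py i)).
Qed.

(* Main.v *)
(* Let z be a primitive p-th root of unity.  Let n = 2p^s.  For e = 1 or -1 and
   0 <= k < p, the character chi(v) = (e z^k)^(v_0) z^(v_1) of Z_n^h is
   nontrivial, hence an eigenvector of the complement, for the eigenvalue
   theta(e, k) = -1 - \sum_(x in S) chi(x).  As p divides no first coordinate of
   an element of S, \sum_k theta(e, k) = -p, whatever e.  On the other hand
   chi(b - a) = e, so PGST gives exp(-i t_j theta(e, k)) --> gamma e.  The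
   product over k shows that exp(i t_j p) tends to (gamma e)^p for both signs
   e; since p is odd, gamma^p = - gamma^p, whence gamma = 0. *)
Require Import Defs.
From mathcomp Require Import all_boot all_order all_algebra.
From mathcomp Require Import complex spectral sesquilinear ring.
From mathcomp Require Import all_classical all_reals all_analysis.
Import Order.TTheory GRing.Theory Num.Theory.
Import numFieldNormedType.Exports.
Local Open Scope classical_set_scope.
Local Open Scope ring_scope.
Set Implicit Arguments.
Unset Strict Implicit.
Unset Printing Implicit Defensive.

(** * Limits of matrices, finite sums and finite products *)

Section Limits.
Variable K : numFieldType.

(** A ball of matrices is a product of balls over a finite index set, so finitely many eventual
    conditions have to be combined. *)
Lemma cvg_mx (T : Type) (F : set_system T) {FF : Filter F} (m n : nat)
    (f : T -> 'M[K]_(m, n)) (M : 'M[K]_(m, n)) :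
  (forall i j, (fun x => f x i j) @ F --> M i j) -> f @ F --> M.
Proof.
move=> fM; apply/cvg_ballP => e e0.
have : \forall x \near F, forall ij : 'I_m * 'I_n,
    ball (M ij.1 ij.2) e (f x ij.1 ij.2).
  by apply: filter_forall => -[i j]; exact: (cvg_ball (fM i j)).
by apply: filterS => x fx; split=> // i j; exact: (fx (i, j)).
Qed.

Lemma cvg_mx_coord (T : Type) (F : set_system T) {FF : Filter F} (m n : nat)
    (f : T -> 'M[K]_(m, n)) (M : 'M[K]_(m, n)) i j :
  f @ F --> M -> (fun x => f x i j) @ F --> M i j.
Proof.
move=> fM.
exact: (@cvg_comp _ _ _ f (fun N : 'M[K]_(m, n) => N i j) _ _ _ fM
  (@coord_continuous K m n i j M)).
Qed.

Lemma cvg_bigsum (I : Type) (s : seq I) (T : Type) (F : set_system T)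
    {FF : Filter F} (f : I -> T -> K) (l : I -> K) :
  (forall i, f i @ F --> l i) ->
  (fun x => \sum_(i <- s) f i x) @ F --> \sum_(i <- s) l i.
Proof.
move=> fl; elim: s => [|i s IHs].
  rewrite big_nil; under eq_fun do rewrite big_nil; exact: cvg_cst.
rewrite big_cons; under eq_fun do rewrite big_cons.
by apply: cvgD => //; exact: fl.
Qed.

Lemma cvg_mulmx (T : Type) (F : set_system T) {FF : Filter F} (m n p : nat)
    (f : T -> 'M[K]_(m, n)) (g : T -> 'M[K]_(n, p))
    (M : 'M[K]_(m, n)) (N : 'M[K]_(n, p)) :
  f @ F --> M -> g @ F --> N -> (fun x => f x *m g x) @ F --> M *m N.
Proof.
move=> fM gN; apply: cvg_mx => i j.
rewrite mxE; under eq_fun do rewrite mxE.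
by apply: cvg_bigsum => k; apply: cvgM; exact: cvg_mx_coord.
Qed.

Lemma cvg_bigprod (I : Type) (s : seq I) (T : Type)
    (F : set_system T) {FF : Filter F} (f : I -> T -> K) (l : I -> K) :
  (forall i, f i @ F --> l i) ->
  (fun x => \prod_(i <- s) f i x) @ F --> \prod_(i <- s) l i.
Proof.
move=> fl; elim: s => [|i s IHs].
  rewrite big_nil; under eq_fun do rewrite big_nil; exact: cvg_cst.
rewrite big_cons; under eq_fun do rewrite big_cons.
by apply: cvgM => //; exact: fl.
Qed.

Lemma cvg_mulIr (T : Type) (F : set_system T)
    {FF : Filter F} (f : T -> K) (l c : K) :
  c != 0 -> (fun x => f x * c) @ F --> l * c -> f @ F --> l.
Proof.
move=> c0 fl; rewrite -(mulfK c0 l) (_ : f = fun x => f x * c * c^-1).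
  by apply: cvgM fl _; exact: cvg_cst.
by apply/funext => x; rewrite mulfK.
Qed.

End Limits.

(** * Exponential of a diagonalizable matrix *)

Lemma expr_conj_diag (K : fieldType) (n : nat) (P : 'M[K]_n) (d : 'rV[K]_n) k :
  P \in unitmx -> (invmx P *m diag_mx d *m P) ^+ k =
    invmx P *m diag_mx (\row_i d 0 i ^+ k) *m P.
Proof.
move=> Pu; elim: k => [|k IHk].
  rewrite expr0 -[LHS](mulVmx Pu) -[in LHS](mulmx1 (invmx P)).
  congr (_ *m _ *m _).
  by apply/matrixP => i j; rewrite !mxE expr0.
rewrite exprS IHk -[RHS]mul1mx -[1%:M](mulVmx Pu).
rewrite -!mulmxE !mulmxA mulmxK //; congr (_ *m _).
rewrite mulVmx // mul1mx -!mulmxA; congr (_ *m _).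
rewrite mulmx_diag; congr diag_mx.
by apply/rowP => i; rewrite !mxE exprS.
Qed.

(** Conjugation by [P] commutes with partial sums, which leaves one scalar exponential series per
    diagonal entry. *)
Lemma expmx_conj_diag (K : numClosedFieldType) (n : nat) (P : 'M[K]_n)
    (d E : 'rV[K]_n) :
  P \in unitmx ->
  (forall i, series (fun k => (k`!%:R)^-1 * d 0 i ^+ k) @ \oo --> E 0 i) ->
  expmx (invmx P *m diag_mx d *m P) = invmx P *m diag_mx E *m P.
Proof.
move=> Pu dE; apply: cvg_lim; first exact: norm_hausdorff.
pose D N : 'M[K]_n := diag_mx
  (\row_i series (fun k => (k`!%:R)^-1 * d 0 i ^+ k) N).
rewrite [X in X @ \oo --> _](_ : _ = (fun N => invmx P *m D N *m P));
  last first.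
  apply/funext => N; rewrite /series /=.
  under eq_bigr do rewrite expr_conj_diag // scalemxAl scalemxAr.
  rewrite -mulmx_suml -mulmx_sumr; congr (_ *m _ *m _).
  apply/matrixP => i j; rewrite summxE !mxE /series /= -sumrMnl.
  by apply: eq_bigr => k _; rewrite !mxE mulrnAr.
apply: cvg_mulmx; last exact: cvg_cst.
apply: cvg_mulmx; first exact: cvg_cst.
apply: cvg_mx => i j; rewrite mxE.
under eq_fun do rewrite !mxE.
have [->|_] := eqVneq i j; last exact: cvg_cst.
exact: dE.
Qed.

(** In the coordinates [v = u *m invmx P], the eigenvector equation confines the support of [v] to
    the indices where [d] is [a], and there [E] is [e]. *)
Lemma mulmx_conj_diag_eigen (K : fieldType) (n : nat) (P : 'M[K]_n)
    (d E u : 'rV[K]_n) (a e : K) :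
  P \in unitmx -> u *m (invmx P *m diag_mx d *m P) = a *: u ->
  (forall i, d 0 i = a -> E 0 i = e) ->
  u *m (invmx P *m diag_mx E *m P) = e *: u.
Proof.
move=> Pu; set v := u *m invmx P; have uE : u = v *m P by rewrite mulmxKV.
rewrite !mulmxA -/v uE; move: v {uE} => v.
rewrite !scalemxAl => /(can_inj (mulmxK Pu)) vd dE.
congr (_ *m _); apply/rowP => i; move/rowP/(_ i): vd.
rewrite !mul_mx_diag !mxE mulrC; have [->|x0] := eqVneq (v 0 i) 0.
  by rewrite !(mul0r, mulr0).
by move=> /(mulIf x0) /dE ->; rewrite mulrC.
Qed.

(** * The complex exponential through cosine and sine *)

Section ComplexExp.
Variable R : realType.

(* [expNi x] is exp(-ix). *)
Definition expNi (x : R) : Cplx R := Complex (cos x) (- sin x).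

Lemma expNiD x y : expNi (x + y) = expNi x * expNi y.
Proof.
rewrite /expNi cosD sinD; apply/eqP; rewrite eq_complex /=; apply/andP; split.
  by rewrite mulrNN.
by rewrite mulNr mulrN -opprD addrC.
Qed.

Lemma expNi_sum (I : Type) (s : seq I) (f : I -> R) :
  expNi (\sum_(i <- s) f i) = \prod_(i <- s) expNi (f i).
Proof.
apply: (big_morph expNi expNiD).
by rewrite /expNi cos0 sin0 oppr0.
Qed.

Lemma cvg_Complex (u v : nat -> R) (a b : R) :
  u @ \oo --> a -> v @ \oo --> b ->
  (fun k => Complex (u k) (v k) : Cplx R) @ \oo --> (Complex a b : Cplx R).
Proof.
move=> ua vb; apply/cvgrPdist_lt => e.
(* A positive [e] in the complex field has zero imaginary part, so [complex.Re e] is the radius to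
   halve. *)
rewrite ltcE /= => /andP[/eqP e0 re0]; near=> k.
rewrite normc_def ltcE /= e0 eqxx /=.
have ha : `|a - u k| < complex.Re e / 2.
  by near: k; move/cvgrPdist_lt : ua; apply; rewrite divr_gt0.
have hb : `|b - v k| < complex.Re e / 2.
  by near: k; move/cvgrPdist_lt : vb; apply; rewrite divr_gt0.
apply: (@le_lt_trans _ _ (`|a - u k| + `|b - v k|)); last first.
  by rewrite [ltRHS]splitr ltrD.
(* Squaring reduces sqrt(x^2 + y^2) <= |x| + |y| to 0 <= 2|x||y|. *)
rewrite -[leRHS]ger0_norm ?addr_ge0 // -sqrtr_sqr ler_sqrt ?sqr_ge0 //.
rewrite [leRHS]sqrrD !real_normK ?num_real // lerD2r lerDl.
by rewrite mulrn_wge0 // mulr_ge0.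
Unshelve. all: by end_near. Qed.

(** The two parts are given the shape of [cos_coeff] and [sin_coeff]. At [k = 0] the truncated
    [k.-1] is harmless, as its factor [odd k] is 0. *)
Lemma exprNi k : (- 'i%C : Cplx R) ^+ k =
  Complex ((~~ odd k)%:R * (-1) ^+ k./2) (- ((odd k)%:R * (-1) ^+ k.-1./2)).
Proof.
have sqr m : (- 'i%C : Cplx R) ^+ m.*2 = ((((-1) ^+ m : R))%:C)%C.
  by rewrite -muln2 mulnC exprM sqrrN sqr_i rmorphXn /= rmorphN1.
have [m [b ->]] : exists m (b : bool), k = (b + m.*2)%N.
  by exists k./2, (odd k); rewrite odd_double_half.
case: b => /=; rewrite ?add0n ?add1n ?exprS sqr /= ?odd_double ?doubleK /=.
  by apply/eqP; rewrite eq_complex /= uphalf_double; simpc.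
by rewrite mul1r mul0r oppr0.
Qed.

Lemma exp_coeffNi (x : R) k :
  (k`!%:R)^-1 * ((- 'i%C * (x%:C)%C : Cplx R) ^+ k) =
  Complex (cos_coeff x k) (- sin_coeff x k).
Proof.
have -> : (k`!%:R : Cplx R) = ((k`!%:R : R)%:C)%C by rewrite rmorph_nat.
rewrite exprMn exprNi -rmorphXn -fmorphV /cos_coeff /sin_coeff /= -exprnP.
set u := x ^+ k; set w := (k`!%:R : R)^-1.
set c := _%:R * _; set d := _%:R * _.
by apply/eqP; rewrite eq_complex /=; apply/andP; split; apply/eqP; ring.
Qed.

Lemma cvg_expNi (x : R) :
  series (fun k => (k`!%:R)^-1 * ((- 'i%C * (x%:C)%C : Cplx R) ^+ k)) @ \oo
    --> expNi x.
Proof.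
rewrite (_ : series _ =
  (fun N => Complex (series (cos_coeff x) N) (- series (sin_coeff x) N))).
  apply: cvg_Complex; last apply: cvgN.
    (* Unlocked, [cos x] is by definition the limit of its series, so only convergence remains. *)
    by rewrite unlock; exact: is_cvg_series_cos_coeff.
  by rewrite unlock; exact: is_cvg_series_sin_coeff.
apply/funext => N; rewrite /series /=.
under eq_bigr do rewrite exp_coeffNi.
elim: N => [|N IHN]; first by rewrite !big_geq // oppr0.
by rewrite !big_nat_recr //= IHN; apply/eqP; rewrite eq_complex /= opprD !eqxx.
Qed.

End ComplexExp.

(** * Transition matrices and state transfer tested on eigenvectors *)

Section Transition.
Variables (R : realType) (V : finType) (e : rel V).
Hypothesis e_sym : symmetric e.

(** The adjacency matrix is real symmetric, so the spectral theorem diagonalizes it with real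
    eigenvalues; this is why [expNi] may be applied to real parts. *)
Lemma transmx_eigen (u : 'rV[Cplx R]_#|V|) (c : Cplx R) (t : R) :
  u *m adjmx R e = c *: u ->
  u *m transmx e t = expNi (t * complex.Re c) *: u.
Proof.
rewrite /transmx; set A := adjmx R e => uc.
have A_herm : A \is hermsymmx.
  apply: realsym_hermsym.
    apply/is_hermitianmxP; rewrite expr0 scale1r map_mx_id //.
    by apply/matrixP => i j; rewrite !mxE e_sym.
  by apply/mxOverP => i j; rewrite mxE realn.
have /mxOverP d_real := hermitian_spectral_diag_real A_herm.
have /orthomx_spectralP A_eq := hermitian_normalmx A_herm.
have Pu := spectral_unit A.
set P := spectralmx A in A_eq Pu; set d := spectral_diag A in A_eq d_real.
set z := - 'i%C * _.
have -> : z *: A = invmx P *m diag_mx (z *: d) *m P.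
  by rewrite A_eq linearZ /= -scalemxAr -scalemxAl.
rewrite (@expmx_conj_diag _ _ _ _ (\row_i expNi (t * complex.Re (d 0 i)))) //.
  apply: (@mulmx_conj_diag_eigen _ _ _ d _ _ c) => //; first by rewrite -A_eq.
  by move=> i dc; rewrite mxE dc.
move=> i; rewrite !mxE.
have -> : z * d 0 i = - 'i%C * ((t * complex.Re (d 0 i))%:C)%C.
  by rewrite rmorphM /= RRe_real // /z mulrA.
exact: cvg_expNi.
Qed.

(** Multiplying the limit on the left by an eigenvector makes it scalar. The same [t] and [gamma]
    serve all eigenvectors, so limits for different eigenvalues can later be multiplied. *)
Lemma pgst_eigen (a b : V) : pgst R e a b ->
  exists (t : nat -> R) (gamma : Cplx R), gamma != 0 /\
  forall (u : 'rV[Cplx R]_#|V|) (c : Cplx R), u *m adjmx R e = c *: u ->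
  (fun k => expNi (t k * complex.Re c) * u 0 (enum_rank a)) @ \oo
    --> gamma * u 0 (enum_rank b).
Proof.
move=> [t [gamma [g1 tg]]]; exists t, gamma; split.
  by rewrite -normr_eq0 g1 oner_eq0.
move=> u c uc.
have /(@cvg_mx_coord _ _ _ _ _ _ _ _ ord0 ord0) :
    (fun k => u *m (transmx e (t k) *m vertex_vec R a)) @ \oo
      --> u *m (gamma *: vertex_vec R b).
  by apply: cvg_mulmx => //; exact: cvg_cst.
have uv (w : 'rV[Cplx R]_#|V|) v :
    (w *m vertex_vec R v) ord0 ord0 = w 0 (enum_rank v).
  by rewrite -colE mxE.
rewrite -scalemxAr mxE uv.
by under eq_fun do rewrite mulmxA (transmx_eigen _ uc) -scalemxAl mxE uv.
Qed.

End Transition.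

(** * Cayley graphs: symmetry, and characters as eigenvectors *)

Lemma cayley_sym (G : finZmodType) (S : {set G}) :
  (forall x, (- x \in S) = (x \in S)) -> symmetric (cayley S).
Proof. by move=> SN x y; rewrite /cayley eq_sym -SN opprB. Qed.

Lemma graph_compl_sym (V : finType) (e : rel V) :
  symmetric e -> symmetric (graph_compl e).
Proof. by move=> e_sym x y; rewrite /graph_compl eq_sym e_sym. Qed.

Section Characters.
Variables (R : realType) (G : finZmodType) (chi : G -> Cplx R).
Hypothesis chiD : forall x y, chi (x + y) = chi x * chi y.

Definition char_row : 'rV[Cplx R]_#|G| := \row_i chi (enum_val i).

(** Translation by [x] permutes the group and multiplies the sum by [chi x]. *)
Lemma sum_char (x : G) : chi x != 1 -> \sum_y chi y = 0.
Proof.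
move=> chix; have /eqP := erefl (\sum_y chi y).
rewrite {1}(reindex_inj (addrI x)) /=.
under eq_bigr do rewrite chiD.
rewrite -mulr_sumr -subr_eq0 -{2}[\sum_y _]mul1r -mulrBl mulf_eq0.
by rewrite subr_eq0 (negPf chix) /= => /eqP.
Qed.

(** The complement has matrix J - I - A, where J is all ones and A is the matrix of the Cayley
    graph; J annihilates a nontrivial character. On the diagonal this uses [0 \notin S]. *)
Lemma char_row_cayley_compl (S : {set G}) (x : G) :
  0 \notin S -> chi x != 1 ->
  char_row *m adjmx R (graph_compl (cayley S)) =
  - (1 + \sum_(x in S) chi (- x)) *: char_row.
Proof.
move=> S0 chix; apply/rowP => j; rewrite !mxE; set w := enum_val j.
rewrite (reindex (@enum_rank G)) /=; last first.
  by apply: onW_bij; exact: enum_rank_bij.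
under eq_bigr => v _.
  rewrite !mxE enum_rankK -/w.
  have -> : (graph_compl (cayley S) v w)%:R =
      1 - (v == w)%:R - (w - v \in S)%:R :> Cplx R.
    rewrite /graph_compl /cayley; have [->|_] /= := eqVneq v w.
      by rewrite !subrr (negPf S0) subr0.
    by case: (_ \in S); rewrite !(subr0, subrr).
  rewrite !mulrBr mulr1.
  over.
rewrite !sumrB (sum_char chix) sub0r.
have -> : \sum_v chi v * (v == w)%:R = chi w.
  by under eq_bigr do rewrite mulr_natr mulrb; rewrite -big_mkcond big_pred1_eq.
have -> : \sum_v chi v * (w - v \in S)%:R = chi w * \sum_(v in S) chi (- v).
  (* Substitutes w - v for v, which turns the condition w - v in [S] into v in [S]. *)
  rewrite (reindex_inj (inj_comp oppr_inj (addIr (- w)))) /=.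
  rewrite mulr_sumr [RHS]big_mkcond; apply: eq_bigr => v _.
  rewrite !opprB addrCA subrr addr0 chiD.
  by case: (v \in S); rewrite ?mulr1 ?mulr0.
by rewrite mulNr mulrDl mul1r opprD [X in _ = _ - X]mulrC.
Qed.

End Characters.

(** * Roots of unity *)

Lemma exists_primitive_root (K : numClosedFieldType) (p : nat) :
  prime p -> exists z : K, p.-primitive_root z.
Proof.
move=> p_pr; have p_gt1 := prime_gt1 p_pr; have p_gt0 := prime_gt0 p_pr.
(* A root of 1 + X + ... + X^(p-1) has order dividing [p]; order 1 is excluded because the value at
   1 is [p], nonzero in [K]. *)
have [z rz] : exists z : K, root (\poly_(i < p) 1) z.
  apply/closed_rootP; rewrite size_poly_eq ?oner_eq0 //.
  by rewrite gtn_eqF.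
have {}rz : \sum_(i < p) z ^+ i = 0.
  by move/rootP: rz; rewrite horner_poly; under eq_bigr do rewrite mul1r.
have zp : z ^+ p = 1 by apply/eqP; rewrite -subr_eq0 subrX1 rz mulr0.
have [m pm mp] := prim_order_exists p_gt0 zp.
exists z; suff <- : m = p by [].
apply: (prime_nt_dvdP p_pr _ mp); apply/eqP => m1.
move: (prim_expr_order pm) rz; rewrite m1 expr1 => ->.
under eq_bigr do rewrite expr1n.
by rewrite sumr_const card_ord => /eqP; rewrite pnatr_eq0 gtn_eqF.
Qed.

Lemma sum_expr_unity_root (K : fieldType) (p : nat) (z : K) :
  z ^+ p = 1 -> z != 1 -> \sum_(i < p) z ^+ i = 0.
Proof.
move=> zp z1; apply/eqP; have /eqP := subrX1 z p.
by rewrite zp subrr eq_sym mulf_eq0 subr_eq0 (negPf z1).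
Qed.

(** Representatives add only modulo [n], and [z ^+ n = 1] absorbs the reduction. For [n <= 1] the
    type ['Z_n] would not have modulus [n]. *)
Lemma expr_ZpD (K : pzRingType) (n : nat) (z : K) (x y : 'Z_n) :
  (1 < n)%N -> z ^+ n = 1 -> z ^+ (x + y)%R = z ^+ x * z ^+ y.
Proof.
move=> n_gt1 zn; rewrite -exprD /= [X in (_ %% X)%N]Zp_cast //.
by rewrite expr_mod.
Qed.

(** * The connection set on the first axis, and the contradiction *)

Lemma axis_connE (p s h m : nat) (y : 'I_m -> 'Z_(2 * p ^ s)) x :
  prime p -> (0 < s)%N -> (forall i, ~~ (p %| y i)%N) ->
  x \in axis_conn h y -> exists2 z, x = first_axis h z & ~~ (p %| z)%N.
Proof.
move=> p_pr s_gt0; set n := (2 * p ^ s)%N in y x * => py.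
have n_gt1 : (1 < n)%N.
  by apply: (@leq_trans (2 * 1)%N); rewrite // leq_mul2l expn_gt0 prime_gt0.
have pn : (p %| n)%N by rewrite dvdn_mull // dvdn_exp.
rewrite finset.inE => /orP[] /imsetP[i _ ->]; first by exists (y i).
exists (n - y i)%N%:R => //.
have yn : (y i <= n)%N by rewrite -[X in (_ <= X)%N](Zp_cast n_gt1) ltnW.
(* Reduction modulo [n] preserves divisibility by [p] because [p] divides [n]. *)
by rewrite val_Zp_nat // /dvdn modn_dvdm // -/(dvdn _ _) dvdn_subr.
Qed.

(** Isolates the arithmetic of [n = 2 * p ^ s] and [q = p ^ s]. As [n] is even and divisible by [p],
    a sign times a power of [zeta] is an [n]-th root of unity, so the characters are well defined on
    ['Z_n]. *)
Lemma axis_compl_no_pgst (R : realType) (n p q h : nat)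
    (S : {set 'rV['Z_n]_h}) (a b : 'rV['Z_n]_h) :
  (1 < h)%N -> prime p -> odd p -> ~~ odd n -> (1 < n)%N -> (p %| n)%N ->
  (q < n)%N -> odd q -> (p %| q)%N ->
  (forall x, (- x \in S) = (x \in S)) ->
  (forall x, x \in S -> exists2 z, x = first_axis h z & ~~ (p %| z)%N) ->
  b - a = first_axis h q%:R ->
  ~ pgst R (graph_compl (cayley S)) a b.
Proof.
move=> h_gt1 p_pr p_odd n_even n_gt1 pn q_n q_odd pq SN S_axis ba.
have e_sym := graph_compl_sym (cayley_sym SN).
move=> /(pgst_eigen e_sym)[t [gamma [g0 eig]]].
have [zeta zetaP] := exists_primitive_root (Cplx R) p_pr.
have zeta1 k : (zeta ^+ k == 1) = (p %| k)%N by rewrite -(prim_order_dvd zetaP).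
pose j0 : 'I_h := Ordinal (ltnW h_gt1); pose j1 : 'I_h := Ordinal h_gt1.
have first0 z : first_axis h z 0 j0 = z :> 'Z_n by rewrite mxE.
have first1 z : first_axis h z 0 j1 = 0 :> 'Z_n by rewrite mxE.
(* The nonzero frequency [1] in the second coordinate makes every [chi eps k]
   nontrivial: its sum over the whole group vanishes. *)
pose chi (eps : bool) k (v : 'rV['Z_n]_h) : Cplx R :=
  ((-1) ^+ eps * zeta ^+ k) ^+ v 0 j0 * zeta ^+ v 0 j1.
have chi_base eps k : ((-1) ^+ eps * zeta ^+ k : Cplx R) ^+ n = 1.
  rewrite exprMn -!exprM mulnC [(k * n)%N]mulnC !exprM.
  have /eqP -> : zeta ^+ n == 1 by rewrite zeta1.
  by rewrite -signr_odd (negPf n_even) !expr1n mulr1.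
have chiD eps k v w : chi eps k (v + w) = chi eps k v * chi eps k w.
  rewrite /chi !mxE !expr_ZpD //; last by apply/eqP; rewrite zeta1.
  exact: mulrACA.
have chi_nontriv eps k : chi eps k (\row_j (j == j1)%:R) != 1.
  rewrite /chi !mxE eqxx expr0 mul1r.
  by rewrite /= modn_small ?Zp_cast // zeta1 dvdn1 gtn_eqF ?prime_gt1.
have chi_neq0 eps k v : chi eps k v != 0.
  have zeta0 : zeta != 0 by rewrite (prim_root_eq0 zetaP) -lt0n prime_gt0.
  by rewrite mulf_neq0 ?expf_neq0 // mulf_neq0 ?expf_neq0 ?signr_eq0.
have S0 : 0 \notin S.
  apply/negP => /S_axis[z /matrixP/(_ 0 j0)]; rewrite first0 mxE => <-.
  by rewrite dvdn0.
pose theta eps k := - (1 + \sum_(x in S) chi eps k (- x)).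
have sum_theta eps : \sum_(k < p) theta eps k = - p%:R.
  rewrite sumrN big_split /= sumr_const card_ord exchange_big /= big1 ?addr0 //.
  (* Since [- x] also lies in [S], its first coordinate [z] is prime to [p]; hence [zeta ^+ z] is a
     [p]-th root of unity other than 1, and its powers sum to 0. *)
  move=> x; rewrite -SN => /S_axis[z -> pz].
  rewrite /chi first0 first1.
  under eq_bigr do rewrite expr0 mulr1 exprMn [X in _ * X]exprAC.
  rewrite -mulr_sumr sum_expr_unity_root ?mulr0 ?zeta1 //.
  by rewrite exprAC (prim_expr_order zetaP) expr1n.
have lim (eps : bool) : (fun k => expNi (t k * - p%:R)) @ \oo
    --> (gamma * (-1) ^+ eps) ^+ p.
  have -> : (fun k => expNi (t k * - p%:R)) =
      (fun k => \prod_(i < p) expNi (t k * complex.Re (theta eps i))).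
    apply/funext => k; rewrite -expNi_sum -mulr_sumr; congr (expNi (_ * _)).
    rewrite -(raddf_sum (@complex.Re R : Rcomplex R -> R)) sum_theta.
    by rewrite -(rmorph_nat (real_complex R)).
  have -> : (gamma * (-1) ^+ eps) ^+ p = \prod_(i < p) (gamma * (-1) ^+ eps).
    by rewrite prodr_const card_ord.
  apply: cvg_bigprod => i.
  have := eig _ _ (char_row_cayley_compl (chiD eps i) S0 (chi_nontriv eps i)).
  rewrite !mxE !enum_rankK -/(theta eps i).
  have -> : chi eps i b = (-1) ^+ eps * chi eps i a.
    rewrite -(subrK a b) ba chiD; congr (_ * _).
    rewrite /chi first0 first1 expr0 mulr1.
    (* As [q < n], the exponent is [q] itself: being odd it keeps the sign, being a multiple of [p]
       it removes the power of [zeta]. *)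
    rewrite val_Zp_nat // modn_small // exprMn -!exprM.
    rewrite -[in LHS]signr_odd oddM q_odd andbT oddb.
    have /eqP -> : zeta ^+ (i * q) == 1 by rewrite zeta1 dvdn_mull.
    by rewrite mulr1.
  rewrite mulrA; apply: cvg_mulIr; exact: chi_neq0.
have : (gamma * (-1) ^+ false) ^+ p = (gamma * (-1) ^+ true) ^+ p.
  by apply: (cvg_unique (@norm_hausdorff _ _) (lim false) (lim true)).
rewrite !exprMn !expr0 expr1 expr1n -signr_odd p_odd expr1 mulr1 mulrN1.
move=> /eqP; rewrite -subr_eq0 opprK -mulr2n mulrn_eq0 /=.
by rewrite (negPf (expf_neq0 _ g0)).
Qed.

Theorem theorem5p2 (R : realType) (p s h m : nat)
    (y : 'I_m -> 'Z_(2 * p ^ s)) (a b : 'rV['Z_(2 * p ^ s)]_h) :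
  prime p -> odd p -> (1 < s)%N -> (1 < h)%N ->
  (forall i : 'I_m, ~~ (p %| y i)%N) ->
  b - a = first_axis h (p ^ s)%N%:R ->
  ~ pgst R (graph_compl (cayley (axis_conn h y))) a b.
Proof.
move=> p_pr p_odd s_gt1 h_gt1 py ba.
have ps_gt1 : (1 < p ^ s)%N.
  by rewrite -(exp1n s) ltn_exp2r ?prime_gt1 // (ltnW s_gt1).
have n_gt1 : (1 < 2 * p ^ s)%N by rewrite (leq_trans ps_gt1) ?leq_pmull.
have p_ps : (p %| p ^ s)%N by rewrite dvdn_exp // (ltnW s_gt1).
apply: (@axis_compl_no_pgst _ _ p (p ^ s) _ _ _ _ h_gt1) ba => //.
- by rewrite oddM.
- by rewrite dvdn_mull.
- by rewrite ltn_Pmull ?(ltnW ps_gt1).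
- by rewrite oddX p_odd orbT.
- by move=> x; exact: axis_connN.
- by move=> x; apply: axis_connE => //; exact: ltnW.
Qed.
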